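(* Let $L\ge1$ be an integer. Let $\phi:\mathbb{N}^L\to\mathcal{S}_L$ be the map sending each word to its permutation type and let $\mu:\mathcal{S}_L\to\mathbb{N}^L$ be the map defined in the context. Equip $\mathcal{S}_L$ with the discrete order $\pi\le_{\mathcal{S}_L}\pi'\Leftrightarrow\pi=\pi'$, and equip $\mathbb{N}^L$ with the order relation defined by: $s_1^L\le_{\mathbb{N}^L}t_1^L$ if and only if $\phi(s_1^L)=\phi(t_1^L)=:\pi$ and there exist integers $0\le c_{\pi(1)}\le\cdots\le c_{\pi(L)}$ such that $s_k=c_k+t_k$ for $k=1,\dots,L$. Then $(\phi,\mu)$ forms a Galois connection: for all $s_1^L\in\mathbb{N}^L$ and $\pi\in\mathcal{S}_L$, $$\phi(s_1^L)\le_{\mathcal{S}_L}\pi\iff s_1^L\le_{\mathbb{N}^L}\mu(\pi).$$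
   Context: $\mathbb{N}=\{1,2,3,\dots\}$; a word of length $L$ is an element $s_1^L=s_1\cdots s_L\in\mathbb{N}^L$. $\mathcal{S}_L$ is the set of all permutations of $\{1,\dots,L\}$. A word $s_1^L$ is of type $\pi\in\mathcal{S}_L$ if for every $i=1,\dots,L-1$ we have $s_{\pi(i)}\le s_{\pi(i+1)}$, and $\pi(i)<\pi(i+1)$ whenever $s_{\pi(i)}=s_{\pi(i+1)}$. Each word has a unique type, denoted $\phi(s_1^L)$. The map $\mu$: a maximal ascending sequence in a sequence is a block of consecutive terms that is ascending and cannot be extended by the adjacent term on the left or on the right while remaining ascending. Decompose $\pi(1)\cdots\pi(L)$ into its maximal ascending sequences $\pi(1)\cdots\pi(i_1),\ \pi(i_1+1)\cdots\pi(i_2),\ \dots,\ \pi(i_{k-1}+1)\cdots\pi(L)$. Then $\mu(\pi)=s_1^L$ is the word with $s_{\pi(1)}=\cdots=s_{\pi(i_1)}=1$, $s_{\pi(i_1+1)}=\cdots=s_{\pi(i_2)}=2$, $\dots$, $s_{\pi(i_{k-1}+1)}=\cdots=s_{\pi(L)}=k$. *)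

(* Defs.v *)
From Stdlib Require Relation_Definitions.
From HB Require Import structures.
From mathcomp Require Import all_boot all_fingroup.

Set Implicit Arguments.
Unset Strict Implicit.
Unset Printing Implicit Defensive.

(* Positions and letters of a permutation are 0-based ('I_L stands for
   {1, ..., L}); the letters of a word are positive integers, as in the source. *)
Definition pnat := {n : nat | 0 < n}.
Definition word (L : nat) := {ffun 'I_L -> pnat}.

Definition is_type L (s : word L) (p : 'S_L) : bool :=
  [forall i : 'I_L, forall j : 'I_L, (j == i.+1 :> nat) ==>
    (val (s (p i)) <= val (s (p j))) &&
    ((s (p i) == s (p j)) ==> (p i < p j))].

Section TypeExists.
Variables (L : nat) (s : word L).

Let lexw : rel 'I_L := fun i j =>
  (val (s i) < val (s j)) || ((val (s i) == val (s j)) && (i <= j)).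

Let lexw_total : total lexw.
Proof.
by move=> i j; rewrite /lexw; case: (ltngtP (val (s i))) => //= _; exact: leq_total.
Qed.

Let lexw_trans : transitive lexw.
Proof.
move=> j i k; rewrite /lexw => /orP[ij|/andP[/eqP-> ij]] /orP[jk|/andP[/eqP<- jk]].
- by rewrite (ltn_trans ij jk).
- by rewrite ij.
- by rewrite jk.
- by rewrite eqxx (leq_trans ij jk) orbT.
Qed.

Lemma type_exists : exists p, is_type s p.
Proof.
set e := sort lexw (enum 'I_L).
have se : size e = L by rewrite size_sort size_enum_ord.
have ue : uniq e by rewrite sort_uniq enum_uniq.
pose f (i : 'I_L) := nth i e i.
have f_inj : injective f.
  move=> i j; rewrite /f (set_nth_default j) ?se // => /eqP.
  by rewrite nth_uniq ?se // => /eqP/val_inj.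
exists (perm f_inj); apply/'forall_forallP => i j; apply/implyP => /eqP ji.
have ij : i < j by rewrite ji.
have lij : lexw (f i) (f j).
  rewrite /f (set_nth_default j i) ?se //.
  apply: (sorted_ltn_nth lexw_trans) => //; rewrite ?inE ?se //.
  exact: sort_sorted.
have nij : f i != f j by rewrite (inj_eq f_inj) neq_ltn ij.
rewrite !permE; move: lij; rewrite /lexw.
case/orP=> [lt|/andP[/eqP eqs le]].
  by rewrite ltnW //=; apply/implyP=> /eqP E; rewrite E ltnn in lt.
by rewrite eqs leqnn /= ltn_neqAle le andbT; apply/implyP.
Qed.

Lemma type_unique p q : is_type s p -> is_type s q -> p = q.
Proof.
have lexw_anti i j : lexw i j -> lexw j i -> i = j.
  by rewrite /lexw; case: ltngtP => //= _ ij ji; apply/val_inj/anti_leq/andP.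
have srt r : is_type s r -> sorted lexw [seq r i | i <- enum 'I_L].
  move=> /'forall_forallP tr; case El: (enum 'I_L) => [|x0 l] //; rewrite -El.
  apply/(sortedP (r x0)) => k; rewrite size_map size_enum_ord => kL.
  rewrite !(nth_map x0) -?enumT ?size_enum_ord ?(ltnW kL) //.
  have := tr (nth x0 (enum 'I_L) k) (nth x0 (enum 'I_L) k.+1).
  rewrite !nth_enum_ord ?(ltnW kL) // eqxx /lexw /= => /andP[].
  rewrite leq_eqVlt => /orP[/eqP E|->] //.
  by rewrite E eqxx (val_inj E) eqxx /= => /ltnW->; rewrite orbT.
move=> tp tq; have : [seq p i | i <- enum 'I_L] = [seq q i | i <- enum 'I_L].
  apply: (sorted_eq lexw_trans _ (srt _ tp) (srt _ tq)).
    by move=> i j /andP[]; exact: lexw_anti.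
  apply: uniq_perm; rewrite ?map_inj_uniq -?enumT ?enum_uniq //; try exact: perm_inj.
  move=> x; apply/mapP/mapP => _.
    by exists (q^-1 x)%g; rewrite ?mem_enum ?permKV.
  by exists (p^-1 x)%g; rewrite ?mem_enum ?permKV.
by move=> /eq_in_map E; apply/permP => i; apply: E; rewrite mem_enum.
Qed.

End TypeExists.

Definition phi L (s : word L) : 'S_L := xchoose (type_exists s).

Lemma phiP L (s : word L) : is_type s (phi s).
Proof. exact: xchooseP. Qed.

(* The decomposition of a sequence into its maximal e-ascending blocks, listed
   from left to right; see runsP. *)
Fixpoint runs (T : Type) (e : rel T) (w : seq T) : seq (seq T) :=
  if w is x :: w' then
    match runs e w' with
    | (y :: r) :: rs =>
        if e x y then [:: x, y & r] :: rs else [:: [:: x], y :: r & rs]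
    | rs => [:: x] :: rs
    end
  else [::].

Lemma runsP (T : Type) (e : rel T) (x0 : T) (w : seq T) :
  [/\ flatten (runs e w) = w,
      all (fun r => (0 < size r) && sorted e r) (runs e w)
    & sorted (fun r r' => ~~ e (last x0 r) (head x0 r')) (runs e w)].
Proof.
elim: w => //= x w [fw aw sw].
case: (runs e w) fw aw sw => [|[|y r] rs] //= => [<- //|<-].
move=> /andP[sr ars] prs; case: ifPn => exy /=; rewrite ?exy ?sr ?ars //=.
by split=> //; case: rs {ars} prs.
Qed.

(* The letter at k is the 1-based rank of the run of p(1)...p(L) containing k. *)
Definition mu L (p : 'S_L) : word L :=
  [ffun k => exist (fun n => 0 < n)
     (find (fun r => k \in r)
        (runs (fun a b : 'I_L => a < b) [seq p i | i <- enum 'I_L])).+1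
     (ltn0Sn _)].

Definition le_perm L (p q : 'S_L) : Prop := p = q.

Definition le_word L (s t : word L) : Prop :=
  phi s = phi t /\
  exists c : 'I_L -> nat,
    (forall i j : 'I_L, j = i.+1 :> nat -> c (phi t i) <= c (phi t j)) /\
    (forall k : 'I_L, val (s k) = c k + val (t k)).

Definition galois_connection (A B : Type)
    (leA : A -> A -> Prop) (leB : B -> B -> Prop) (f : A -> B) (g : B -> A) :=
  [/\ Relation_Definitions.order A leA, Relation_Definitions.order B leB
    & forall a b, leB (f a) b <-> leA a (g b)].

(* Main.v *)
Require Import Defs.
From mathcomp Require Import all_boot all_fingroup.

Set Implicit Arguments.
Unset Strict Implicit.
Unset Printing Implicit Defensive.

(** Along p(1), ..., p(L) the word [mu p] starts at 1 and increases by one at each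
    descent of p and nowhere else.  A word of type p must also increase strictly at
    each descent of p, so [mu p] is of type p, and for every word s of type p the
    difference [s - mu p] is nonnegative and nondecreasing along p. *)

(** The letter of [mu] before the successor, so 0-based, freed from permutations so that induction
    on the sequence is possible. *)
Definition run_rank (T : eqType) (e : rel T) (w : seq T) (k : T) : nat :=
  find (fun r => k \in r) (runs e w).

(** Over a nonempty tail, this leaves only the branch of [runs] that compares [x] with the head of
    the next block. *)
Lemma runs_cons (T : Type) (e : rel T) (x : T) (w : seq T) :
  exists r rs, runs e (x :: w) = (x :: r) :: rs.
Proof.
rewrite /=; case: (runs e w) => [|[|y r] rs]; try by do 2 eexists.
by case: ifP => _; do 2 eexists.
Qed.

Lemma run_rank_head (T : eqType) (e : rel T) (x : T) (w : seq T) :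
  run_rank e (x :: w) x = 0.
Proof.
by rewrite /run_rank; have [r [rs ->]] := runs_cons e x w; rewrite /= mem_head.
Qed.

(** Either [x] joins the first block and no other rank changes, or it forms a new block and shifts
    all later ranks by one. *)
Lemma run_rank_cons (T : eqType) (e : rel T) (x y z : T) (w : seq T) :
  z != x -> run_rank e [:: x, y & w] z = ~~ e x y + run_rank e (y :: w) z.
Proof.
move=> zx; have [r [rs E]] := runs_cons e y w.
(* Unfolds [runs] exactly once, keeping [runs e (y :: w)] intact for [E]. *)
rewrite /run_rank -[runs e [:: x, y & w]]/(match runs e (y :: w) with
    | (y :: r) :: rs =>
        if e x y then [:: x, y & r] :: rs else [:: [:: x], y :: r & rs]
    | rs => [:: x] :: rs end) E.
by case: (e x y); rewrite /= !in_cons (negPf zx).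
Qed.

Lemma run_rank_step (T : eqType) (e : rel T) (x0 : T) (w : seq T) (i : nat) :
  uniq w -> i.+1 < size w ->
  run_rank e w (nth x0 w i.+1) =
    run_rank e w (nth x0 w i) + ~~ e (nth x0 w i) (nth x0 w i.+1).
Proof.
elim: w i => // x [|y w] IHw [|i] /andP[xw uw] // lt_i.
  rewrite [nth x0 _ 0]/= [nth x0 _ 1]/= run_rank_cons; last first.
    by apply: contraNneq xw => <-; rewrite mem_head.
  by rewrite !run_rank_head addn0.
have nx j : j < size (y :: w) -> nth x0 (y :: w) j != x.
  by move=> lt_j; apply: contraNneq xw => <-; rewrite mem_nth.
rewrite -[nth x0 [:: x, y & w] i.+2]/(nth x0 (y :: w) i.+1).
rewrite -[nth x0 [:: x, y & w] i.+1]/(nth x0 (y :: w) i).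
have lt_i' : i.+1 < size (y :: w) by [].
by rewrite !run_rank_cons ?nx ?(ltnW lt_i') // IHw // addnA.
Qed.

Lemma mu_run_rank L (p : 'S_L) (k : 'I_L) :
  val (mu p k) = (run_rank (fun a b : 'I_L => a < b) [seq p i | i <- enum 'I_L] k).+1.
Proof. by rewrite ffunE. Qed.

Lemma nth_perm_enum L (p : 'S_L) (x0 i : 'I_L) :
  nth x0 [seq p i | i <- enum 'I_L] i = p i.
Proof. by rewrite (nth_map x0) ?size_enum_ord // nth_ord_enum. Qed.

Lemma mu_first L (p : 'S_L) (i : 'I_L) : i = 0 :> nat -> val (mu p (p i)) = 1.
Proof.
move=> i0; rewrite mu_run_rank -(nth_perm_enum p i i) i0.
have : 0 < size [seq p i | i <- enum 'I_L].
  by rewrite size_map size_enum_ord -i0.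
by case: [seq _ | _ <- _] => // x w _; rewrite run_rank_head.
Qed.

Lemma mu_step L (p : 'S_L) (i j : 'I_L) :
  j = i.+1 :> nat -> val (mu p (p j)) = val (mu p (p i)) + ~~ (p i < p j).
Proof.
move=> ji; have := @run_rank_step _ (fun a b : 'I_L => a < b) i
  [seq p i | i <- enum 'I_L] i.
rewrite -ji !nth_perm_enum !mu_run_rank => -> //.
  by rewrite map_inj_uniq ?enum_uniq //; exact: perm_inj.
by rewrite size_map size_enum_ord.
Qed.

Lemma mu_is_type L (p : 'S_L) : is_type (mu p) p.
Proof.
apply/'forall_forallP => i j; apply/implyP => /eqP ji.
rewrite -val_eqE (mu_step _ ji) leq_addr /=.
by case: (p i < p j); rewrite ?implybT // addn1 ltn_eqF.
Qed.

Lemma phi_mu L (p : 'S_L) : phi (mu p) = p.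
Proof. exact: type_unique (phiP _) (mu_is_type p). Qed.

(** At a descent the tie-breaking condition of a type excludes equal letters, so the weak inequality
    becomes strict. *)
Lemma type_step L (s : word L) (i j : 'I_L) : j = i.+1 :> nat ->
  val (s (phi s i)) + ~~ (phi s i < phi s j) <= val (s (phi s j)).
Proof.
move=> ji; have /'forall_forallP/(_ i j) := phiP s.
rewrite ji eqxx -val_eqE /=; case: (phi s i < phi s j); first by rewrite addn0 => /andP[].
by rewrite implybF andbC addn1 ltn_neqAle.
Qed.

Lemma mu_phi_le L (s : word L) (k : 'I_L) : val (mu (phi s) k) <= val (s k).
Proof.
(* Writing [k] as the image of its index under [phi s] lets the induction run along [phi s]; the
   base case holds because letters are at least 1. *)
rewrite -(permKV (phi s) k); move: (_ k) => -[n].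
elim: n => [|n IHn] lt_n; first by rewrite mu_first // (valP (s _)).
pose i := Ordinal (ltnW lt_n); pose j := Ordinal lt_n.
have ji : j = i.+1 :> nat by [].
by rewrite (mu_step _ ji) (leq_trans _ (type_step s ji)) // leq_add2r IHn.
Qed.

Lemma le_word_mu_phi L (s : word L) : le_word s (mu (phi s)).
Proof.
split; first by rewrite phi_mu.
exists (fun k => val (s k) - val (mu (phi s) k)); split=> [i j ji|k]; last first.
  by rewrite subnK // mu_phi_le.
(* The descent indicator is added to both terms of the left difference, so that both sides subtract
   the same number. *)
rewrite phi_mu (mu_step _ ji) -(subnDr (~~ (phi s i < phi s j))).
by rewrite leq_sub2r // type_step.
Qed.

Lemma le_word_order L : Relation_Definitions.order (word L) (@le_word L).
Proof.
split.
- by move=> s; split=> //; exists (fun=> 0).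
- move=> s t u [st [c [mc sE]]] [tu [d [md tE]]]; split; first by rewrite st.
  exists (fun k => c k + d k); split=> [i j ji|k]; last by rewrite sE tE addnA.
  by rewrite leq_add ?md // -tu mc.
(* Antisymmetry: the shifts are natural numbers, so each word dominates the other letter by
   letter. *)
- move=> s t [_ [c [_ sE]]] [_ [d [_ tE]]]; apply/ffunP=> k; apply: val_inj.
  by apply/anti_leq; rewrite {1}tE leq_addl sE leq_addl.
Qed.

Theorem mainTheorem4 (L : nat) (hL : 1 <= L) :
  galois_connection (@le_word L) (@le_perm L) (@phi L) (@mu L).
Proof.
split; first exact: le_word_order.
  by split; [move=> p | move=> p q r -> | move=> p q].
move=> s p; split=> [<-|[-> _]]; first exact: le_word_mu_phi.
exact: phi_mu.
Qed.
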